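(* Let $\psi: T \to \mathbb{C}$ be a function and $\varphi: T \to T$ a self-map for which $C_\varphi$ and $M_\psi$ are bounded on $L_\mu^0$. (a) For the composition operator $C_\varphi$: (i) if $\varphi$ has finite range, then $C_\varphi$ is compact on $L_\mu^0$; (ii) if $\varphi$ has infinite range, then $C_\varphi$ is compact on $L_\mu^0$ if and only if $$\lim_{N\to\infty}\ \sup_{|\varphi(v)| \ge N} \frac{\mu(v)}{\mu(\varphi(v))} = 0,$$ where the supremum is over all $v \in T$ with $|\varphi(v)| \ge N$; (iii) if $\varphi$ has infinite range and $\mu$ is a typical weight, i.e. $\lim_{|v|\to\infty}\mu(v)=0$, then $C_\varphi$ is compact on $L_\mu^0$ if and only if $$\lim_{|v|\to\infty} \frac{\mu(v)}{\mu(\varphi(v))} = 0.$$ (b) The operator $M_\psi$ is compact on $L_\mu^0$ if and only if $\lim_{|v|\to\infty} |\psi(v)| = 0$.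
   Context: $(T,\mathrm{d})$ is a metric space with a distinguished point $o$ (the root); the length of $v \in T$ is $|v| = \mathrm{d}(o,v)$. $T$ is assumed locally finite (for every $M>0$ the set $\{v \in T : |v| < M\}$ is finite) and unbounded (for every $M>0$ there is $v \in T$ with $|v| \ge M$). $\mu: T \to (0,\infty)$ is a positive function (a weight). $L_\mu^\infty$ is the Banach space of functions $f: T \to \mathbb{C}$ with $\|f\|_\mu = \sup_{v \in T} \mu(v)|f(v)| < \infty$, and $L_\mu^0$ is its closed subspace of those $f$ with $\lim_{|v|\to\infty} \mu(v)|f(v)| = 0$. The composition and multiplication operators are the linear maps $C_\varphi f = f\circ\varphi$ and $M_\psi f = \psi f$; such an operator is bounded (compact) on $L_\mu^0$ if it is a bounded (compact) operator from $L_\mu^0$ to itself. $\varphi$ has finite (infinite) range if the set $\varphi(T)$ is finite (infinite). *)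

(* Defs.v *)
From HB Require Import structures.
From mathcomp Require Import all_boot all_order all_algebra.
From mathcomp Require Import all_classical all_reals all_analysis.
From mathcomp Require Export complex.

Set Implicit Arguments.
Unset Strict Implicit.
Unset Printing Implicit Defensive.

Import Order.TTheory GRing.Theory Num.Theory.
Import numFieldNormedType.Exports.

Local Open Scope classical_set_scope.
Local Open Scope complex_scope.
Local Open Scope ring_scope.

(* The modulus of a complex number as an element of R; in MathComp `|z| lives
   in R[i]. *)
Notation cmod := (@ComplexField.Normc.normc _).

Section rooted_space.
Context {R : realType} {T : metricType R}.

Definition len (o v : T) : R := mdist o v.

Definition locally_finite (o : T) :=
  forall M : R, 0 < M -> finite_set [set v | len o v < M].

Definition unbounded (o : T) :=
  forall M : R, 0 < M -> exists v, M <= len o v.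

(* The filter "|v| --> +oo"; it is proper as soon as T is unbounded. *)
Definition at_infty (o : T) : set_system T :=
  filter_from [set: R] (fun M => [set v | M <= len o v]).

#[global] Instance at_infty_filter (o : T) : Filter (at_infty o).
Proof.
apply: filter_from_filter; first by exists 0.
move=> M N _ _; exists (Num.max M N) => // v /=.
by rewrite ge_max => /andP[].
Qed.

Definition typical_weight (o : T) (mu : T -> {posnum R}) :=
  (mu v)%:num @[v --> at_infty o] --> (0 : R).

End rooted_space.

Section weighted_spaces.
Context {R : realType} {T : metricType R} (o : T) (mu : T -> {posnum R}).

Definition wmod (f : T -> R[i]) (v : T) : R := (mu v)%:num * cmod (f v).

(* Only meaningful on Linfty, as sup is 0 on unbounded sets. *)
Definition wnorm (f : T -> R[i]) : R := sup (range (wmod f)).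

Definition Linfty : set (T -> R[i]) := [set f | has_ubound (range (wmod f))].

Definition L0 : set (T -> R[i]) :=
  [set f | Linfty f /\ wmod f v @[v --> at_infty o] --> (0 : R)].

Definition L0_pred : {pred T -> R[i]} := mem L0.

Lemma cmod_ge0 (z : R[i]) : 0 <= cmod z.
Proof. by case: z => a b /=; rewrite sqrtr_ge0. Qed.

Lemma wmod_ge0 f v : 0 <= wmod f v.
Proof. by rewrite mulr_ge0// cmod_ge0. Qed.

Lemma wmodD f g v : wmod (f + g) v <= wmod f v + wmod g v.
Proof. by rewrite /wmod -mulrDr ler_wpM2l// le_normcD. Qed.

Lemma wmodZ (a : R[i]) f v : wmod (a *: f) v = cmod a * wmod f v.
Proof.
by rewrite /wmod [X in cmod X](_ : _ = a * f v)// ComplexField.Normc.normcM mulrCA.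
Qed.

Lemma wmod0 v : wmod 0 v = 0.
Proof.
by rewrite /wmod [X in cmod X](_ : _ = 0)// ComplexField.Normc.normc0 mulr0.
Qed.

Lemma wnorm_ub f v : Linfty f -> wmod f v <= wnorm f.
Proof. by move=> bf; apply: ub_le_sup => //; exists v. Qed.

Lemma wnorm_le f (M : R) : (forall v, wmod f v <= M) -> wnorm f <= M.
Proof.
move=> fM; apply: ge_sup; first by exists (wmod f o), o.
by move=> _ [v _ <-].
Qed.

Lemma L0_submod_closed : submod_closed L0_pred.
Proof.
split.
  rewrite inE; split; first by exists 0 => _ [v _ <-]; rewrite wmod0.
  by under eq_cvg do rewrite wmod0; exact: cvg_cst.
move=> a f g; rewrite !inE => -[[M fM] f0] [[N gN] g0]; split.
  exists (cmod a * M + N) => _ [v _ <-].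
  rewrite (le_trans (wmodD _ _ _))// lerD//; last by apply: gN; exists v.
  by rewrite wmodZ ler_wpM2l// ?cmod_ge0//; apply: fM; exists v.
apply: (@squeeze_cvgr _ _ _ _ (cst 0) (fun v => cmod a * wmod f v + wmod g v)).
- apply: nearW => v; rewrite wmod_ge0/= -wmodZ; exact: wmodD.
- exact: cvg_cst.
- rewrite [X in _ --> X](_ : 0 = cmod a * 0 + 0); last by rewrite mulr0 addr0.
  by apply: cvgD => //; apply: cvgMl_tmp.
Qed.

HB.instance Definition _ := GRing.isSubmodClosed.Build R[i] (T -> R[i]) L0_pred
  L0_submod_closed.

Record L0_type := MkL0 { L0_val :> T -> R[i]; _ : L0_val \in L0_pred }.

HB.instance Definition _ := [isSub for L0_val].
HB.instance Definition _ := [Choice of L0_type by <:].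
HB.instance Definition _ := [SubChoice_isSubLmodule of L0_type by <:].

Lemma L0_Linfty (f : L0_type) : Linfty f.
Proof. by have := valP f; rewrite inE => -[]. Qed.

Definition L0_norm (f : L0_type) : R[i] := (wnorm f)%:C.

Lemma L0_normD f g : L0_norm (f + g) <= L0_norm f + L0_norm g.
Proof.
rewrite /L0_norm -rmorphD/= lecR; apply: wnorm_le => v.
by rewrite (le_trans (wmodD _ _ _))// lerD// wnorm_ub//; exact: L0_Linfty.
Qed.

Lemma wnormZ_le (a : R[i]) (f : T -> R[i]) :
  Linfty f -> wnorm (a *: f) <= cmod a * wnorm f.
Proof.
move=> bf; apply: wnorm_le => v.
by rewrite wmodZ ler_wpM2l ?cmod_ge0// wnorm_ub.
Qed.

Lemma L0_normZ (a : R[i]) (f : L0_type) : L0_norm (a *: f) = `|a| * L0_norm f.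
Proof.
have -> : `|a| = (cmod a)%:C by [].
rewrite /L0_norm -rmorphM/=; congr (_%:C); apply/eqP.
rewrite eq_le wnormZ_le ?andTb; last exact: L0_Linfty.
have [->|a0] := eqVneq a 0.
  rewrite ComplexField.Normc.normc0 mul0r; apply: le_trans (wmod_ge0 _ o) _.
  by apply: wnorm_ub; exact: (L0_Linfty (0 *: f)).
have na0 : 0 < cmod a.
  rewrite lt0r cmod_ge0 andbT; apply: contra a0 => /eqP/ComplexField.Normc.eq0_normc.
  by move=> ->.
rewrite -ler_pdivlMl// -ComplexField.Normc.normcV.
rewrite {1}(_ : L0_val f = a^-1 *: L0_val (a *: f)).
  by apply: wnormZ_le; exact: L0_Linfty.
have -> : L0_val (a *: f) = a *: L0_val f by [].
by rewrite scalerA mulVf// scale1r.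
Qed.

Lemma L0_norm_eq0 (f : L0_type) : L0_norm f = 0 -> f = 0.
Proof.
move=> /(congr1 (@complex.Re R)) /= f0; apply: val_inj; apply/funext => v.
apply: ComplexField.Normc.eq0_normc; apply/eqP.
have := wnorm_ub v (L0_Linfty f); rewrite f0 => fv.
have : wmod f v == 0 by rewrite eq_le fv wmod_ge0.
by rewrite mulf_eq0 gt_eqF.
Qed.

HB.instance Definition _ := Lmodule_isNormed.Build R[i] L0_type
  L0_normD L0_normZ L0_norm_eq0.

End weighted_spaces.

Section operators.
Context {K : numFieldType} {V : normedModType K}.

Definition bounded_operator (B : {linear V -> V}) :=
  exists M : K, forall f : V, `|B f| <= M * `|f|.

Definition compact_operator (B : {linear V -> V}) :=
  forall A : set V, bounded_set A -> precompact (B @` A).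

End operators.

Section weighted_operators.
Context {R : realType} {T : metricType R}.

Definition comp_op (phi : T -> T) (f : T -> R[i]) : T -> R[i] := f \o phi.

Definition mul_op (psi : T -> R[i]) (f : T -> R[i]) : T -> R[i] :=
  fun v => psi v * f v.

(* A is defined on all functions T -> C; the witness B exhibits A as a linear
   operator from L^0_mu to itself. *)
Definition bounded_on_L0 (o : T) (mu : T -> {posnum R})
    (A : (T -> R[i]) -> (T -> R[i])) :=
  exists2 B : {linear L0_type o mu -> L0_type o mu},
    (forall f, L0_val (B f) = A (L0_val f)) & bounded_operator B.

Definition compact_on_L0 (o : T) (mu : T -> {posnum R})
    (A : (T -> R[i]) -> (T -> R[i])) :=
  exists2 B : {linear L0_type o mu -> L0_type o mu},
    (forall f, L0_val (B f) = A (L0_val f)) & compact_operator B.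

End weighted_operators.

(* Main.v *)
(* Both operators are weighted compositions W f v = u v * f (phi v), and
   mu v |W f v| = r v * (mu |f|)(phi v) with r v = mu v |u v| / mu (phi v).
   W is compact iff r v becomes small uniformly where |phi v| is large.

   If so, r also vanishes at infinity: W maps the indicator of a point w into
   L^0, so r tends to 0 on each fiber of phi.  Hence W maps every function f
   with mu |f| bounded into L^0, and on a box of such functions it is continuous
   from the product topology to the norm.  Boxes are compact by Tychonoff, and
   the image of a bounded set lies in the image of a box.

   Conversely, let w = phi v tend to infinity with r v > e, and take the unit
   functions f_w = indicator of w over mu w.  W f_w tends to 0 pointwise, so 0
   is the only possible cluster point, yet ||W f_w|| > e. *)
Require Import Defs.
From HB Require Import structures.
From mathcomp Require Import all_boot all_order all_algebra.
From mathcomp Require Import all_classical all_reals all_analysis.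
From mathcomp Require Import complex.

Set Implicit Arguments.
Unset Strict Implicit.
Unset Printing Implicit Defensive.

Import Order.TTheory GRing.Theory Num.Theory.
Import numFieldNormedType.Exports.

Local Open Scope classical_set_scope.
Local Open Scope ring_scope.

(** * Limits along [at_infty] in a locally finite space *)

Section at_infinity.
Context {R : realType} {T : metricType R} (o : T).

Lemma filter_finite_forall (I : eqType) (S : Type) (F : set_system S)
    (D : set I) (P : I -> set S) :
  Filter F -> finite_set D -> (forall i, D i -> F (P i)) ->
  F [set x | forall i, D i -> P i x].
Proof.
move=> FF /finite_seqP[s ->]; elim: s => [|i s IH] FP.
  by apply: nearW => x.
apply: (@filterS2 _ _ _ (P i) [set x | forall j, j \in s -> P j x]).
- by move=> x Pi Ps j /=; rewrite inE => /orP[/eqP -> //|]; exact: Ps.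
- by apply: FP; rewrite /= mem_head.
- by apply: IH => j js; apply: FP; rewrite /= inE js orbT.
Qed.

Lemma at_infty_cvg0P (f : T -> R) : (forall v, 0 <= f v) ->
  f v @[v --> at_infty o] --> (0 : R) <->
  forall e, 0 < e -> exists M, forall v, M <= len o v -> f v <= e.
Proof.
move=> f0; rewrite cvgr0Pnorm_le; split => + e e0 => /(_ e e0).
  by move=> [M _ HM]; exists M => v /HM /=; rewrite ger0_norm.
by move=> [M HM]; exists M => // v /= /HM; rewrite ger0_norm.
Qed.

Lemma locally_finite_lt (M : R) : locally_finite o ->
  finite_set [set v | len o v < M].
Proof.
move=> hfin; have h : 0 < Num.max M 1 by rewrite lt_max ltr01 orbT.
by apply: sub_finite_set (hfin _ h) => v /= vM; rewrite lt_max vM.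
Qed.

Lemma finite_set_ub (I : eqType) (D : set I) (g : I -> R) : finite_set D ->
  exists2 M, 0 < M & forall i, D i -> g i <= M.
Proof.
move=> Dfin.
have H : \forall M \near +oo, 0 < M /\ forall i, D i -> g i <= M.
  near=> M; split; first by near: M; apply: nbhs_pinfty_gt; rewrite num_real.
  near: M; apply: filter_finite_forall => // i Di.
  by apply: nbhs_pinfty_ge; rewrite num_real.
by have [M [M0 HM]] := filter_ex H; exists M.
Unshelve. all: by end_near. Qed.

(** Outside some ball [f] is at most 1, and the ball is a finite set. *)
Lemma at_infty_cvg0_ub (f : T -> R) : locally_finite o ->
  (forall v, 0 <= f v) -> f v @[v --> at_infty o] --> (0 : R) ->
  exists2 C, 0 < C & forall v, f v <= C.
Proof.
move=> hfin f0 /(at_infty_cvg0P f0) /(_ 1 ltr01) [M HM].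
have [C C0 HC] := finite_set_ub f (locally_finite_lt M hfin).
exists (Num.max C 1); first by rewrite lt_max C0.
move=> v; rewrite le_max; have [/HM ->|vM] := leP M (len o v); first by rewrite orbT.
by rewrite HC.
Qed.

End at_infinity.

(** * Modulus against real and imaginary parts *)

Section complex_modulus.
Context {R : realType}.

Lemma cmod_le_addr (x y : R) : cmod (x +i* y)%C <= `|x| + `|y|.
Proof.
rewrite /= -[leRHS]ger0_norm ?addr_ge0// -[leRHS]sqrtr_sqr ler_wsqrtr//.
by rewrite sqrrD !real_normK ?num_real// addrAC lerDl mulrn_wge0// mulr_ge0.
Qed.

Lemma Re_le_cmod (z : R[i]) : `|complex.Re z| <= cmod z.
Proof. by case: z => x y /=; rewrite -sqrtr_sqr ler_wsqrtr// lerDl sqr_ge0. Qed.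

Lemma Im_le_cmod (z : R[i]) : `|complex.Im z| <= cmod z.
Proof. by case: z => x y /=; rewrite -sqrtr_sqr ler_wsqrtr// lerDr sqr_ge0. Qed.

Lemma cmod_real (x : R) : cmod (x%:C)%C = `|x|.
Proof. by rewrite /= expr0n/= addr0 sqrtr_sqr. Qed.

End complex_modulus.

(** * Weighted compositions and the decay of their ratio *)

Section weighted_composition.
Context {R : realType} {T : metricType R} (o : T) (mu : T -> {posnum R}).
Context (hfin : locally_finite o).
Notation L0 := (L0_type o mu).

(** Local finiteness turns decay into boundedness, so only the limit has to be checked. *)
Lemma L0_cvg0 (f : T -> R[i]) :
  wmod mu f v @[v --> at_infty o] --> (0 : R) -> Defs.L0 o mu f.
Proof.
move=> f0; split=> //.
have [C _ HC] := at_infty_cvg0_ub hfin (wmod_ge0 mu f) f0.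
by exists C => _ [v _ <-].
Qed.

Lemma wmodN f v : wmod mu (- f) v = wmod mu f v.
Proof. by rewrite /wmod normcN. Qed.

Lemma L0_typeP (f : L0) : Defs.L0 o mu (L0_val f).
Proof. by have := valP f; rewrite inE. Qed.

Lemma normL0 (f : L0) : `|f| = ((wnorm mu f)%:C)%C.
Proof. by []. Qed.

Definition bump_fun (w v : T) : R[i] :=
  if v == w then (((mu w)%:num)^-1%:C)%C else 0.

Lemma wmod_bump_fun w v : wmod mu (bump_fun w) v = (v == w)%:R.
Proof.
rewrite /wmod /bump_fun; case: eqP => [->|_].
  by rewrite cmod_real ger0_norm ?invr_ge0// mulfV.
by rewrite ComplexField.Normc.normc0 mulr0.
Qed.

Lemma bump_fun_L0 w : bump_fun w \in L0_pred o mu.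
Proof.
rewrite inE; apply: L0_cvg0; apply/at_infty_cvg0P => [v|e e0]; first exact: wmod_ge0.
exists (len o w + 1) => v wv; rewrite wmod_bump_fun.
by case: eqP wv => [->|_ _]; [rewrite gerDl ler10|exact: ltW].
Qed.

Definition bump w : L0 := MkL0 (bump_fun_L0 w).

Lemma wnorm_bump w : wnorm mu (bump w) <= 1.
Proof. by apply: wnorm_le => // v; rewrite wmod_bump_fun; case: eqP. Qed.

Context (u : T -> R[i]) (phi : T -> T).

Definition wcomp_op (f : T -> R[i]) : T -> R[i] := fun v => u v * f (phi v).

Definition wratio (v : T) : R := (mu v)%:num * cmod (u v) / (mu (phi v))%:num.

Lemma wratio_ge0 v : 0 <= wratio v.
Proof. by rewrite divr_ge0// mulr_ge0// cmod_ge0. Qed.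

Lemma wmod_wcomp f v : wmod mu (wcomp_op f) v = wratio v * wmod mu f (phi v).
Proof.
rewrite /wmod /wratio /wcomp_op ComplexField.Normc.normcM.
by rewrite [RHS]mulrA divfK// mulrA.
Qed.

Definition wratio_vanishing :=
  forall e, 0 < e -> exists N, forall v, N <= len o (phi v) -> wratio v <= e.

Context (B : {linear L0 -> L0}).
Context (BE : forall f, L0_val (B f) = wcomp_op (L0_val f)).

(** On the fiber over [w] the ratio is the weighted modulus of [B (bump w)], an element of L^0. *)
Lemma wratio_fiber_cvg0 (w : T) e : 0 < e ->
  \forall v \near at_infty o, phi v = w -> wratio v <= e.
Proof.
move=> e0; have [_] := L0_typeP (B (bump w)).
move=> /(at_infty_cvg0P _ (wmod_ge0 _ _)) /(_ _ e0)[M HM]; exists M => // v /HM + vw.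
by rewrite BE wmod_wcomp /= wmod_bump_fun vw eqxx mulr1.
Qed.

(** Where |phi v| >= N the hypothesis applies directly; the other points lie in finitely many
    fibers, and the ratio decays on each. *)
Lemma wratio_cvg0 : wratio_vanishing ->
  wratio v @[v --> at_infty o] --> (0 : R).
Proof.
move=> van; apply/at_infty_cvg0P => [v|e e0]; first exact: wratio_ge0.
have [N HN] := van e e0.
have [M _ HM] := filter_finite_forall _ (locally_finite_lt N hfin)
  (fun w _ => wratio_fiber_cvg0 w e0).
exists M => v /HM H.
by have [/HN //|vN] := leP N (len o (phi v)); exact: H vN erefl.
Qed.


(** * Vanishing ratio implies compactness *)

Notation coord := (prod_topology (fun _ : T * bool => R : topologicalType)).

(* Functions T -> C are encoded by their real and imaginary parts, so that
   compactness only needs real segments. *)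
Definition cfun (a : coord) : T -> R[i] :=
  fun w => (a (w, false) +i* a (w, true))%C.

(** A product of segments, ready for Tychonoff. It contains the coordinates of every [f] with
    weighted modulus at most [m]; its own members only satisfy the bound [m + m]. *)
Definition box (m : R) : set coord :=
  [set a | forall i, `[- (m / (mu i.1)%:num), m / (mu i.1)%:num]%classic (a i)].

Lemma compact_box m : compact (box m).
Proof.
apply: (@tychonoff _ (fun _ : T * bool => R : topologicalType)
  (fun i => `[- (m / (mu i.1)%:num), m / (mu i.1)%:num]%classic)) => i.
exact: segment_compact.
Qed.

Lemma wmod_cfun_le m a w : box m a -> wmod mu (cfun a) w <= m + m.
Proof.
move=> am; apply: le_trans (_ : (mu w)%:num * (m / (mu w)%:num + m / (mu w)%:num) <= _).
  rewrite /wmod ler_wpM2l// (le_trans (cmod_le_addr _ _))//.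
  by rewrite lerD// ler_norml; [have := am (w, false)|have := am (w, true)];
    rewrite /= in_itv.
by rewrite -mulrDl mulrCA mulfV// mulr1.
Qed.

Context (van : wratio_vanishing).

Lemma wcomp_cvg0 (f : T -> R[i]) (m : R) : (forall v, wmod mu f v <= m) ->
  wmod mu (wcomp_op f) v @[v --> at_infty o] --> (0 : R).
Proof.
move=> fm; apply: (@squeeze_cvgr _ _ _ _ (cst 0) (fun v => m * wratio v)).
- apply: nearW => v; rewrite wmod_ge0 /= wmod_wcomp mulrC.
  by rewrite ler_wpM2r// wratio_ge0.
- exact: cvg_cst.
- rewrite [X in _ --> X](_ : 0 = m * 0); last by rewrite mulr0.
  by apply: cvgMl_tmp; exact: wratio_cvg0.
Qed.

(* Junk value 0 outside the boxes. *)
Definition wcomp_cfun (a : coord) : L0 := insubd (0 : L0) (wcomp_op (cfun a)).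

Lemma wcomp_cfunE m a : box m a -> L0_val (wcomp_cfun a) = wcomp_op (cfun a).
Proof.
move=> am; rewrite /wcomp_cfun; apply: insubdK.
rewrite inE; apply: L0_cvg0; apply: (@wcomp_cvg0 _ (m + m)) => v; exact: wmod_cfun_le.
Qed.

(* The set D collects the points of length below the threshold given by van; off
   D the ratio is small, on D it is merely bounded. *)
Lemma wcomp_cfun_dist m e : 0 < m -> 0 < e -> exists2 D : set T, finite_set D &
  exists2 d, 0 < d & forall a b, box m a -> box m b ->
   (forall w, D w -> wmod mu (cfun a - cfun b) w <= d) ->
   wnorm mu (wcomp_cfun a - wcomp_cfun b) <= e.
Proof.
move=> m0 e0.
have [C C0 HC] := at_infty_cvg0_ub hfin wratio_ge0 (wratio_cvg0 van).
(* Two members of the box differ by at most 4m in weighted modulus, so a ratio of at most e/(4m)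
   suffices when [phi v] is off [D]. When [phi v] is in [D], the global bound [C] on the ratio calls
   for d = e/C. *)
have m4 : 0 < m + m + (m + m) by rewrite !addr_gt0.
have [N HN] := van (divr_gt0 e0 m4).
exists [set w | len o w < N]; first exact: locally_finite_lt.
exists (e / C); first exact: divr_gt0.
move=> a b am bm ab; apply: wnorm_le => // v.
have -> : L0_val (wcomp_cfun a - wcomp_cfun b) = wcomp_op (cfun a - cfun b).
  rewrite [LHS](_ : _ = L0_val (wcomp_cfun a) - L0_val (wcomp_cfun b))//.
  rewrite !(@wcomp_cfunE m)//; apply/funext => w.
  by rewrite /wcomp_op mulrBr.
rewrite wmod_wcomp; have [vN|vN] := leP N (len o (phi v)).
  rewrite -[leRHS](divfK (lt0r_neq0 m4)); apply: ler_pM (HN _ vN) _ => //.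
  - exact: wratio_ge0.
  - exact: wmod_ge0.
  rewrite (le_trans (wmodD _ _ _ _))// lerD ?(wmod_cfun_le _ am)//.
  by rewrite wmodN (wmod_cfun_le _ bm).
rewrite -[leRHS](divfK (lt0r_neq0 C0)) mulrC; apply: ler_pM (ab _ vN) (HC v) => //.
- exact: wmod_ge0.
- exact: wratio_ge0.
Qed.

Lemma wmod_cfunB_le a b w : wmod mu (cfun a - cfun b) w <=
  (mu w)%:num * (`|a (w, false) - b (w, false)| + `|a (w, true) - b (w, true)|).
Proof. by rewrite /wmod ler_wpM2l// cmod_le_addr. Qed.

Lemma near_coord (a : coord) i d : 0 < d ->
  \forall b \near nbhs a, `|a i - (b : coord) i| <= d.
Proof.
move=> d0.
have nd : nbhs (a i : R) [set x | `|a i - x| <= d].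
  by apply/nbhs_ballP; exists d => // x; rewrite /ball/= => /ltW.
exact: (@proj_continuous _ (fun _ : T * bool => R : topologicalType) i a _ nd).
Qed.

(** The distance estimate looks at finitely many points, hence at finitely many coordinates, which a
    neighborhood in the product topology controls. *)
Lemma wcomp_cfun_continuous m : 0 < m -> {within box m, continuous wcomp_cfun}.
Proof.
move=> m0; apply/subspace_continuousP => a am; apply/cvgrPdist_le => -[e e'] /=.
(* A positive element of [R[i]] has zero imaginary part, so the radius is real. *)
rewrite ltcE/= => /andP[/eqP -> {e'} e0].
have [D Dfin [d d0 HD]] := wcomp_cfun_dist m0 e0.
have H : \forall b \near nbhs a,
    forall w, D w -> wmod mu (cfun a - cfun b) w <= d.
  apply: filter_finite_forall => // w Dw.
  (* The real and imaginary parts each receive half of [d], rescaled by the weight. *)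
  have nearD i : \forall b \near nbhs a,
      `|a i - (b : coord) i| <= d / (2 * (mu w)%:num).
    by apply: near_coord; rewrite divr_gt0// mulr_gt0.
  apply: filterS2 (nearD (w, false)) (nearD (w, true)) => b b0 b1.
  apply: le_trans (wmod_cfunB_le _ _ _) _.
  by rewrite mulrC -ler_pdivlMr// (le_trans (lerD b0 b1))// invfM mulrA -mulrDl -splitr.
rewrite near_withinE; apply: filterS H => b Hb bm.
by rewrite normL0 lecR; exact: HD.
Qed.

Lemma wratio_vanishing_compact : compact_operator B.
Proof.
move=> A /ex_strict_bound_gt0[[m m'] + HA].
rewrite ltcE/= => /andP[/eqP m'0 m0]; subst m'.
apply: (@precompact_subset _ _ (wcomp_cfun @` box m)); last first.
  apply: compact_precompact; first exact: norm_hausdorff.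
  by apply: continuous_compact (@compact_box m); exact: wcomp_cfun_continuous.
move=> _ [f Af <-].
pose a : coord := fun i => if i.2 then complex.Im (f i.1) else complex.Re (f i.1).
have cfunE : cfun a = f by apply/funext => w; rewrite /cfun/a/=; case: (L0_val f w).
have fm v : wmod mu f v <= m.
  apply: le_trans (wnorm_ub _ (L0_Linfty _)) _.
  by have := HA _ Af; rewrite /= normL0 ltcR => /ltW.
have am : box m a.
  move=> [w c]; rewrite /= in_itv/= -ler_norml ler_pdivlMr//.
  rewrite mulrC (le_trans _ (fm w))// ler_wpM2l//.
  by case: c; rewrite /a/= ?Im_le_cmod ?Re_le_cmod.
exists a => //; apply: val_inj; rewrite /= (wcomp_cfunE am) cfunE.
by rewrite BE.
Qed.

(** * Compactness implies vanishing ratio *)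

Lemma compact_wratio_vanishing : compact_operator B -> wratio_vanishing.
Proof.
move=> Bcpt; apply: contrapT => /existsNP[e] /not_implyP[e0] /forallNP nvan.
have {}nvan N : exists v, N <= len o (phi v) /\ e < wratio v.
  by have /existsNP[v /not_implyP[vN /negP]] := nvan N; rewrite -ltNge; exists v.
(* The filter generated by these tails stands in for a sequence of bumps escaping to infinity. *)
pose E N := [set B (bump (phi v)) |
  v in [set v | N <= len o (phi v) /\ e < wratio v]].
pose F := filter_from [set: R] E.
have FF : ProperFilter F.
  apply: filter_from_proper => [|N _].
    apply: filter_from_filter; first by exists 0.
    move=> M N _ _; exists (Num.max M N) => // _ [v [+ ev] <-].
    by rewrite ge_max => /andP[Mv Nv]; split; exists v.
  by have [v Nv] := nvan N; exists (B (bump (phi v))), v.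
have bumps_bounded : bounded_set (range bump : set L0).
  exists 1; split; first exact: real1.
  move=> M M1 _ [w _ <-]; rewrite /= normL0 (le_trans _ (ltW M1))//.
  by rewrite -[1]/((1 : R)%:C)%C lecR wnorm_bump.
have := Bcpt _ bumps_bounded; rewrite precompactE => /(_ F FF)[].
  exists 0 => // _ [v _ <-]; apply: subset_closure.
  by exists (bump (phi v)) => //; exists (phi v).
move=> g [_ gF].
(* The cluster point [g] is uniformly approximated, in weighted modulus, by images of bumps
   arbitrarily far out. *)
have approx N d : 0 < d -> exists v, [/\ N <= len o (phi v), e < wratio v &
    forall w, wmod mu (L0_val g - wcomp_op (bump_fun (phi v))) w <= d].
  move=> d0.
  have d0' : 0 < (d%:C)%C :> R[i] by rewrite ltcR.
  have [||_ [[v [Nv ev] <-] gv]] := gF (E N) (ball g (d%:C)%C).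
  - by exists N.
  - exact: nbhsx_ballx.
  exists v; split=> // w; move: gv; rewrite -ball_normE /ball_/= normL0 ltcR => /ltW.
  apply: le_trans; have := wnorm_ub w (L0_Linfty (g - B (bump (phi v)))).
  apply: le_trans; rewrite [X in wmod mu X](_ : _ = L0_val g - L0_val (B (bump (phi v))))//.
  by rewrite BE.
(* A bump at length at least |phi v| + 1 vanishes at [phi v], so its image vanishes at [v]. *)
have g0 v : L0_val g v = 0.
  have gv : wmod mu (L0_val g) v <= 0.
    apply/ler_addgt0Pr => d d0; rewrite add0r.
    have [v' [Nv' _ /(_ v)]] := approx (len o (phi v) + 1) d d0.
    rewrite /wmod (_ : (_ - _) v = L0_val g v)//.
    rewrite [LHS](_ : _ = L0_val g v - u v * bump_fun (phi v') (phi v))//.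
    rewrite /bump_fun; case: eqP => [vv'|_]; last by rewrite mulr0 subr0.
    by move: Nv'; rewrite -vv' gerDl ler10.
  apply: ComplexField.Normc.eq0_normc; apply/eqP.
  by rewrite eq_le cmod_ge0 andbT; move: gv; rewrite /wmod pmulr_rle0.
(* An image within [e] of g = 0 still has weighted modulus [wratio v] > e at its own [v]. *)
have [v [_ ev /(_ v)]] := approx 0 e e0.
have -> : wmod mu (L0_val g - wcomp_op (bump_fun (phi v))) v = wratio v.
  have -> : L0_val g = 0 by apply/funext.
  by rewrite sub0r wmodN wmod_wcomp wmod_bump_fun eqxx mulr1.
by rewrite leNgt ev.
Qed.

End weighted_composition.

(** * Limit criteria and the final assembly *)

Lemma ereal_sup_tail_cvg0P (R : realType) (T : Type) (g h : T -> R) :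
  (forall v, 0 <= g v) -> (forall N, exists v, N <= h v) ->
  ereal_sup [set (g v)%:E | v in [set v | N <= h v]] @[N --> +oo%R] --> 0%E <->
  forall e, 0 < e -> exists N, forall v, N <= h v -> g v <= e.
Proof.
move=> g0 hN; set S := fun N => ereal_sup _.
(* By [hN] no tail is empty; an empty one would have supremum -oo. *)
have S0 N : (0 <= S N)%E.
  have [v Nv] := hN N; apply: (@le_trans _ _ (g v)%:E); first by rewrite lee_fin.
  by apply: ereal_sup_ubound; exists v.
rewrite fine_cvgP cvgr0Pnorm_le; split.
  move=> [Sfin S_cvg] e e0; have [N [NS Ne]] := filter_ex (filterI Sfin (S_cvg e e0)).
  exists N => v Nv; rewrite -lee_fin.
  apply: (@le_trans _ _ (S N)); first by apply: ereal_sup_ubound; exists v.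
  by rewrite -(fineK NS) lee_fin (le_trans (ler_norm _)).
move=> H.
have Se e : 0 < e -> \forall N \near +oo, (S N <= e%:E)%E.
  move=> /H[N HN]; apply: filterS (nbhs_pinfty_ge (num_real N)) => M NM.
  apply: ge_ereal_sup => _ [v Mv <-].
  by rewrite lee_fin HN// (le_trans NM).
split.
  apply: filterS (Se 1 ltr01) => N N1.
  by rewrite ge0_fin_numE// (le_lt_trans N1)// ltry.
move=> e e0; apply: filterS (Se e e0) => N Ne /=.
have SN : S N \is a fin_num by rewrite ge0_fin_numE// (le_lt_trans Ne)// ltry.
by rewrite ger0_norm ?fine_ge0// -lee_fin fineK.
Qed.

(** Covers both operators: u = 1 for composition, phi = id for multiplication. The witness of
    boundedness serves as the witness of compactness. *)
Lemma compact_on_L0_wcompP (R : realType) (T : metricType R) (o : T)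
    (mu : T -> {posnum R}) (u : T -> R[i]) (phi : T -> T)
    (A : (T -> R[i]) -> (T -> R[i])) :
  locally_finite o -> A = wcomp_op u phi -> bounded_on_L0 o mu A ->
  compact_on_L0 o mu A <-> wratio_vanishing o mu u phi.
Proof.
move=> hfin -> [B BE _]; split=> [[C CE]|van].
  exact: (compact_wratio_vanishing hfin CE).
by exists B => //; exact: (wratio_vanishing_compact hfin BE van).
Qed.

Lemma infinite_range_unbounded (R : realType) (T : metricType R) (o : T)
    (phi : T -> T) : locally_finite o -> infinite_set (range phi) ->
  forall N, exists v, N <= len o (phi v).
Proof.
move=> hfin inf N; apply: contrapT => /forallNP bd; apply: inf.
apply: sub_finite_set (locally_finite_lt N hfin) => _ [v _ <-] /=.
by rewrite ltNge; apply/negP/bd.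
Qed.

Theorem corollary4p7 (R : realType) (T : metricType R) (o : T)
    (mu : T -> {posnum R}) (psi : T -> R[i]) (phi : T -> T)
    (hfin : locally_finite o) (hunb : unbounded o)
    (hC : bounded_on_L0 o mu (comp_op phi))
    (hM : bounded_on_L0 o mu (mul_op psi)) :
  [/\ finite_set (range phi) -> compact_on_L0 o mu (comp_op phi),
      infinite_set (range phi) ->
      (compact_on_L0 o mu (comp_op phi) <->
       ereal_sup [set ((mu v)%:num / (mu (phi v))%:num)%:E |
                   v in [set v | N <= len o (phi v)]]
         @[N --> +oo%R] --> 0%E),
      infinite_set (range phi) -> typical_weight o mu ->
      (compact_on_L0 o mu (comp_op phi) <->
       (mu v)%:num / (mu (phi v))%:num @[v --> at_infty o] --> (0 : R)) &
      compact_on_L0 o mu (mul_op psi) <->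
      cmod (psi v) @[v --> at_infty o] --> (0 : R)].
Proof.
have ratioE : wratio mu (fun=> 1) phi = fun v => (mu v)%:num / (mu (phi v))%:num.
  by apply/funext => v; rewrite /wratio ComplexField.Normc.normc1 mulr1.
have ratio_ge0 v : 0 <= (mu v)%:num / (mu (phi v))%:num by rewrite divr_ge0.
have compE : @comp_op R T phi = wcomp_op (fun=> 1) phi.
  by apply/funext => f; apply/funext => v; rewrite /wcomp_op mul1r.
have CP := compact_on_L0_wcompP hfin compE hC.
split.
- move=> range_fin; apply/CP => e e0.
  have [M _ HM] := finite_set_ub (len o) range_fin.
  (* Beyond the largest length in the range the condition is vacuous. *)
  exists (M + 1) => v; have : len o (phi v) <= M by apply: HM; exists v.
  by move=> vM /le_trans/(_ vM); rewrite gerDl ler10.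
- move=> range_inf.
  rewrite CP ereal_sup_tail_cvg0P//; last exact: infinite_range_unbounded.
  by rewrite /wratio_vanishing ratioE.
- move=> range_inf _; rewrite CP; split=> [van|/(at_infty_cvg0P _ ratio_ge0) ratio0].
    have [B BE _] := hC; rewrite compE in BE.
    by have := wratio_cvg0 hfin BE van; rewrite ratioE.
  move=> e /ratio0[M HM].
  (* [phi] maps the finite ball |v| < M into lengths at most [C], so |phi v| >= C + 1 forces |v| >=
     M. *)
  have [C _ HC] := finite_set_ub (len o \o phi) (locally_finite_lt M hfin).
  exists (C + 1) => v Cv; rewrite ratioE; have [/HM //|/HC vC] := leP M (len o v).
  by move: (le_trans Cv vC); rewrite gerDl ler10.
(* With phi = id the weights cancel and the ratio is |psi v|. *)
- have MP := compact_on_L0_wcompP hfin (erefl (wcomp_op psi id)) hM.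
  rewrite MP at_infty_cvg0P => [|v]; last exact: cmod_ge0.
  rewrite /wratio_vanishing (_ : wratio mu psi id = fun v => cmod (psi v))//.
  by apply/funext => v; rewrite /wratio mulrC mulKf.
Qed.
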